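(* Let $N:A\to A$ be a Nijenhuis operator on a left pre-Jacobi-Jordan algebra $(A,\cdot)$. Then the bilinear map $$\omega(x,y)=(\delta^1N)(x,y):=N(x)\cdot y+x\cdot N(y)-N(x\cdot y),\qquad x,y\in A,$$ generates a linear deformation of $(A,\cdot)$. Furthermore, this deformation is trivial.
   Context: The ground field $\mathbb{K}$ is a field containing $\mathbb{C}$. A left pre-Jacobi-Jordan algebra is a vector space $A$ with a bilinear product $\cdot$ such that $(x\cdot y)\cdot z+x\cdot(y\cdot z)+(y\cdot x)\cdot z+y\cdot(x\cdot z)=0$ for all $x,y,z\in A$; a morphism of such algebras is a linear map $f$ preserving the products. A linear map $N:A\to A$ is a Nijenhuis operator on $(A,\cdot)$ if $N(x)\cdot N(y)=N\big(N(x)\cdot y+x\cdot N(y)-N(x\cdot y)\big)$ for all $x,y\in A$. A bilinear map $\omega:A\times A\to A$ generates a linear deformation of $(A,\cdot)$ if for every $t\in\mathbb{C}$ the product $x\cdot_ty:=x\cdot y+t\,\omega(x,y)$ makes $A$ a left pre-Jacobi-Jordan algebra $A_t=(A,\cdot_t)$. The deformation is trivial if there is a linear map $M:A\to A$ such that for every $t\in\mathbb{C}$ the map $\mathrm{Id}_A+tM:(A,\cdot_t)\to(A,\cdot)$ is a morphism of left pre-Jacobi-Jordan algebras. *)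

(* Defs.v *)
From mathcomp Require Import all_boot all_algebra.
From mathcomp Require Import sesquilinear.
From mathcomp Require Export reals complex.

Set Implicit Arguments.
Unset Strict Implicit.
Unset Printing Implicit Defensive.

Import GRing.Theory.
Local Open Scope ring_scope.

(* The ground field K is a field equipped with a ring morphism iota from R[i], *)
(* R a complete archimedean ordered field; iota is automatically injective,    *)
(* and t *: v for a complex number t means iota t *: v.                        *)

Section LeftPreJacobiJordan.

Variables (K : fieldType) (A : lmodType K).

Record left_pre_JJ (mul : A -> A -> A) : Prop := LeftPreJJ {
  left_pre_JJ_bilinear : bilinear_for *:%R *:%R mul;
  left_pre_JJ_identity : forall x y z : A,
    mul (mul x y) z + mul x (mul y z) + mul (mul y x) z + mul y (mul x z) = 0
}.

(* Morphism from (A, mul1) to (A, mul2): both algebras have carrier A. *)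
Definition algebra_morphism (mul1 mul2 : A -> A -> A) (f : A -> A) : Prop :=
  linear f /\ forall x y : A, f (mul1 x y) = mul2 (f x) (f y).

Definition Nijenhuis (mul : A -> A -> A) (N : {linear A -> A}) : Prop :=
  forall x y : A,
    mul (N x) (N y) = N (mul (N x) y + mul x (N y) - N (mul x y)).

Definition delta1 (mul : A -> A -> A) (N : A -> A) (x y : A) : A :=
  mul (N x) y + mul x (N y) - N (mul x y).

Variables (R : realType) (iota : {rmorphism R[i] -> K}).

Definition deformed_mul (mul omega : A -> A -> A) (t : R[i]) (x y : A) : A :=
  mul x y + iota t *: omega x y.

Definition generates_linear_deformation (mul omega : A -> A -> A) : Prop :=
  bilinear_for *:%R *:%R omega /\
  forall t : R[i], left_pre_JJ (deformed_mul mul omega t).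

Definition trivial_deformation (mul omega : A -> A -> A) : Prop :=
  exists M : {linear A -> A}, forall t : R[i],
    algebra_morphism (deformed_mul mul omega t) mul
      (fun x => x + iota t *: M x).

End LeftPreJacobiJordan.

(* Main.v *)
(* If N is Nijenhuis then so is P := Id + tN, and delta1 P is exactly the       *)
(* deformed product at t; so it suffices to show that delta1 P is a left        *)
(* pre-Jacobi-Jordan product for every Nijenhuis P (the Nijenhuis identity says *)
(* that P is then a morphism to the original product). Both iterated products   *)
(* of delta1 P are obtained from the original trilinear ones (xy)z and x(yz) by *)
(* the same additive operator [polarize], which thus preserves the identity.    *)
From HB Require Import structures.
Require Import Defs.
From mathcomp Require Import all_boot all_algebra.
From mathcomp Require Import sesquilinear boolp.

Import GRing.Theory.
Local Open Scope ring_scope.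

(** For injective P, applying P to the identity for [delta1 mul P] reduces it at once to the
    identity for [mul]. But Id + tN need not be injective, so the iterated products are computed
    outright ([delta1_delta1l], [delta1_delta1r]). The link with the deformation is
    [delta1_id_plus_scale] and [Nijenhuis_id_plus_scale]. *)

Section Nijenhuis.

Variables (K : fieldType) (A : lmodType K).
Implicit Types (N P : {linear A -> A}) (s : K).

(** Arity-three analogue of [delta1]: with P_i denoting P on the i-th argument, [delta1] is P_1 +
    P_2 - P, and this is e_2 - P e_1 + P^2, where e_k is the elementary symmetric polynomial in P_1,
    P_2, P_3. *)
Definition polarize P (f : A -> A -> A -> A) (x y z : A) : A :=
  f (P x) (P y) z + f (P x) y (P z) + f x (P y) (P z)
  - P (f (P x) y z + f x (P y) z + f x y (P z) - P (f x y z)).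

Lemma polarizeD P f g x y z :
  polarize P f x y z + polarize P g x y z
  = polarize P (fun x y z => f x y z + g x y z) x y z.
Proof.
have add3 (a b c a' b' c' : A) :
  a + b + c + (a' + b' + c') = a + a' + (b + b') + (c + c').
  by rewrite addrACA [X in X + _]addrACA.
rewrite /polarize addrACA add3 -opprD -raddfD; congr (_ - P _).
by rewrite addrACA add3 -opprD -raddfD.
Qed.

Lemma polarize0 P f x y z :
  (forall x y z, f x y z = 0) -> polarize P f x y z = 0.
Proof. by move=> f0; rewrite /polarize !f0 !(raddf0, addr0, subr0). Qed.

(** Holds because e_1 and e_2 are symmetric; it brings the terms with x and y exchanged to the same
    arguments, so that [polarizeD] can collect all four. *)
Lemma polarize_swap P f x y z :
  polarize P f y x z = polarize P (fun x y z => f y x z) x y z.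
Proof.
rewrite /polarize [X in X - P _ = _]addrAC; congr (_ - P (_ + _ - _)).
exact: addrC.
Qed.

Section Product.

Variable mul : {bilinear A -> A -> A}.

Lemma Nijenhuis_delta1 P x y :
  Nijenhuis mul P -> P (delta1 mul P x y) = mul (P x) (P y).
Proof. by move=> PP; rewrite PP. Qed.

(** The Nijenhuis identity is used at (x, y) for the term where P hits the inner product, then at
    (xy, z) to expand P(xy) P(z); the two copies of P(P(xy) z) cancel. *)
Lemma delta1_delta1l P x y z : Nijenhuis mul P ->
  delta1 mul P (delta1 mul P x y) z
  = polarize P (fun x y z => mul (mul x y) z) x y z.
Proof.
move=> PP; rewrite {1}/delta1 (Nijenhuis_delta1 _ _ _ PP) /delta1 /polarize.
rewrite !linearBl !linearDl (PP (mul x y)) -!addrA; do 3! congr (_ + _).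
rewrite -opprD -raddfD; congr (- P _).
by rewrite [LHS]addrC !addrA subrK.
Qed.

(** Mirror computation, with the Nijenhuis identity at (y, z) and at (x, yz). *)
Lemma delta1_delta1r P x y z : Nijenhuis mul P ->
  delta1 mul P x (delta1 mul P y z)
  = polarize P (fun x y z => mul x (mul y z)) x y z.
Proof.
move=> PP; rewrite {1}/delta1 (Nijenhuis_delta1 _ _ _ PP) /delta1 /polarize.
rewrite !linearBr !linearDr (PP x (mul y z)) -!addrA; do 2! congr (_ + _).
rewrite addrCA; congr (_ + _); rewrite -opprD -raddfD; congr (- P _).
rewrite -!addrA; congr (_ + _).
by rewrite [LHS]addrC !addrA subrK -addrA [LHS]addrC.
Qed.

Lemma delta1_bilinear P : bilinear_for *:%R *:%R (delta1 mul P).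
Proof.
have add3 (a b c a' b' c' : A) :
    a + a' + (b + b') - (c + c') = a + b - c + (a' + b' - c').
  by rewrite opprD [X in X + _]addrACA [LHS]addrACA.
split=> u a x y; rewrite /delta1.
  by rewrite !(linearP P, linearPl) add3 -scalerDr -scalerBr.
by rewrite !(linearP P, linearPr) add3 -scalerDr -scalerBr.
Qed.

Lemma delta1_left_pre_JJ P :
  left_pre_JJ mul -> Nijenhuis mul P -> left_pre_JJ (delta1 mul P).
Proof.
move=> [_ mulJ] PP; split=> [|x y z]; first exact: delta1_bilinear.
rewrite !delta1_delta1l ?delta1_delta1r //.
rewrite ![polarize P _ y x z]polarize_swap !polarizeD.
exact: polarize0.
Qed.

Definition id_plus_scale N s : {linear A -> A} := idfun \+ s \*: N.

(** [delta1] is linear in its operator, and the identity contributes xy + xy - xy = xy. *)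
Lemma delta1_id_plus_scale N s x y :
  delta1 mul (id_plus_scale N s) x y = mul x y + s *: delta1 mul N x y.
Proof.
rewrite /delta1 /= linearDl linearDr linearZl_LR linearZr_LR -addrA.
by rewrite [X in _ + (X - _)]addrC addrKA scalerBr scalerDr !addrA.
Qed.

(** Compare powers of s: the coefficient of s is N(xy) + [delta1 mul N x y] = N(x) y + x N(y), and
    that of s^2 is N(x) N(y) by the Nijenhuis identity for N. *)
Lemma Nijenhuis_id_plus_scale N s :
  Nijenhuis mul N -> Nijenhuis mul (id_plus_scale N s).
Proof.
move=> NP x y; rewrite -/(delta1 _ _ _ _) delta1_id_plus_scale.
rewrite /= (linearD N) (linearZ_LR N) /= Nijenhuis_delta1 //.
rewrite -addrA -scalerDr addrA /delta1 subrK.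
rewrite linearDl !linearDr !linearZl_LR !linearZr_LR.
by rewrite !scalerDr -!addrA; congr (_ + _); rewrite addrCA.
Qed.

Lemma deformed_mul_id_plus_scale (R : realType) (iota : {rmorphism R[i] -> K})
    N t :
  deformed_mul iota mul (delta1 mul N) t
  = delta1 mul (id_plus_scale N (iota t)).
Proof.
by apply/funext => x; apply/funext => y; rewrite delta1_id_plus_scale.
Qed.

End Product.
End Nijenhuis.

Theorem theorem5p4 (R : realType) (K : fieldType)
    (iota : {rmorphism R[i] -> K}) (A : lmodType K) (mul : A -> A -> A)
    (mulP : left_pre_JJ mul) (N : {linear A -> A}) (NP : Nijenhuis mul N) :
  generates_linear_deformation iota mul (delta1 mul N) /\
  trivial_deformation iota mul (delta1 mul N).
Proof.
(* The lemmas above take a bundled bilinear map, so [mul] is packed with the bilinearity contained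
   in [mulP]. *)
pose m : {bilinear A -> A -> A} := HB.pack mul
  (bilinear_isBilinear.Build _ _ _ _ _ _ mul (left_pre_JJ_bilinear mulP)).
have QP t : Nijenhuis m (id_plus_scale _ _ N (iota t)).
  exact: Nijenhuis_id_plus_scale.
rewrite -[mul]/(m : A -> A -> A).
split; first split; first exact: delta1_bilinear.
  move=> t; rewrite deformed_mul_id_plus_scale.
  exact: delta1_left_pre_JJ.
(* With M = N, the map Id + tM is [id_plus_scale] by conversion. *)
exists N => t; rewrite deformed_mul_id_plus_scale.
split=> [|x y]; first exact: (linearP (id_plus_scale _ _ N (iota t))).
exact: (Nijenhuis_delta1 _ _ m (id_plus_scale _ _ N (iota t))).
Qed.
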